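(* Let $(E,\{l_k\}_{k\in\mathbb N})$ and $(V,\{m_k\}_{k\in\mathbb N})$ be Lie $\infty$-algebras (shifted convention, see context), with codifferential $M_V$ on $\bar S(V)$ having components $m_k$, and let $\Phi:(E,\{l_k\}_{k\in\mathbb N})\to(\mathrm{Coder}(\bar S(V))[1],\partial_{M_V},[\cdot,\cdot])$ be a Lie $\infty$-action. Equip $E\oplus V$ with the degree $+1$ multilinear maps $\mathfrak l_n:(E\oplus V)^{\otimes n}\to E\oplus V$, $n\ge 1$, defined by $$\mathfrak l_n(x_1+v_1,\dots,x_n+v_n)=l_n(x_1,\dots,x_n)+\sum_{i=1}^{n-1}\Phi^{i,n-i}(x_1,\dots,x_i;v_{i+1},\dots,v_n)+m_n(v_1,\dots,v_n),$$ for $x_j\in E$, $v_j\in V$. Then the coderivation of the Zinbiel coalgebra $T^Z(E\oplus V)$ determined by $\{\mathfrak l_n\}_{n\in\mathbb N}$ squares to zero (i.e. $(E\oplus V,\{\mathfrak l_n\})$ is a Loday $\infty$-algebra) if and only if $\Phi$ is a coherent action.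
   Context: All vector spaces are $\mathbb Z$-graded over $\mathbb K=\mathbb R$ or $\mathbb C$ and the Koszul sign rule is used; $\epsilon(\sigma)$ denotes the Koszul sign of a permutation $\sigma$ acting on homogeneous elements, and $Sh(i_1,\dots,i_k)$ the set of $(i_1,\dots,i_k)$-unshuffles. For a graded space $V$, $\bar S(V)=\bigoplus_{k\ge1}S^k(V)$ (graded-symmetric powers, product written $\cdot$) carries the coshuffle coproduct $\Delta^c(v_1\cdots v_k)=\sum_{p=1}^{k-1}\sum_{\sigma\in Sh(p,k-p)}\epsilon(\sigma)(v_{\sigma(1)}\cdots v_{\sigma(p)})\otimes(v_{\sigma(p+1)}\cdots v_{\sigma(k)})$, and $p:\bar S(V)\to V$ is the projection; a coderivation $Q$ of $(\bar S(V),\Delta^c)$ is determined by its components $p\circ Q|_{S^k(V)}:S^k(V)\to V$. A Lie $\infty$-algebra (in the shifted, ''Lie[1]'', convention used throughout) is a graded space $V$ with a degree $+1$ coderivation $M_V$ of $(\bar S(V),\Delta^c)$ with $M_V^2=0$; its components $m_k:S^k(V)\to V$ are degree $+1$ graded-symmetric brackets. A Lie $\infty$-morphism $E\to V$ is a degree $0$ coalgebra morphism $F:\bar S(E)\to\bar S(V)$ with $F\circ M_E=M_V\circ F$. For a Lie $\infty$-algebra $(V,M_V)$, the space $\mathrm{Coder}(\bar S(V))[1]$ is a Lie $\infty$-algebra (shifted differential graded Lie algebra) with unary bracket $\partial_{M_V}Q=-M_V\circ Q+(-1)^{|Q|+1}Q\circ M_V$ and binary bracket $[Q,P]=(-1)^{|Q|+1}\big(Q\circ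 P-(-1)^{(|Q|+1)(|P|+1)}P\circ Q\big)$ (no higher brackets). A Lie $\infty$-action of $(E,\{l_k\})$ on $(V,\{m_k\})$ is a Lie $\infty$-morphism $\Phi$ from $E$ to this Lie $\infty$-algebra. For $x\in\bar S(E)$ write $\Phi_x\in\mathrm{Coder}(\bar S(V))$ for the coderivation assigned to $x$ by the components $S^k(E)\to\mathrm{Coder}(\bar S(V))$ of $\Phi$, and set $\Phi^{k,n}(x;v)=p(\Phi_x(v))\in V$ for $x\in S^k(E)$, $v\in S^n(V)$ (written $\Phi^{k,n}(x_1,\dots,x_k;v_1,\dots,v_n)$ for $x=x_1\cdots x_k$, $v=v_1\cdots v_n$); $\Phi^{\bullet,\bullet}$ denotes the sum over all $k,n$. For $v\in S^k(V)$ let $\mathrm{ad}_v$ be the coderivation of $\bar S(V)$ with components $w\mapsto m_{k+i}(v\cdot w)$, $w\in S^i(V)$, extended linearly to $v\in\bar S(V)$. For $y\in\bar S(E)$, $v\in\bar S(V)$ let $\Phi_{y;v}$ be the coderivation of $\bar S(V)$ with components $w\mapsto\Phi^{\bullet,\bullet}(y;v\cdot w)$. The action $\Phi$ is coherent if $[\mathrm{ad}_v,\Phi_x]=0$ and $[\Phi_{y;v},\Phi_x]=0$ for all $x,y\in\bar S(E)$ and $v\in\bar S(V)$. Loday $\infty$-algebras (shifted convention): $\bar T(W)=\bigoplus_{k\ge1}W^{\otimes k}$ with the Zinbiel coproduct $\Delta^Z(w)=0$ for $w\in W$ and $\Delta^Z(w_1\otimes\cdots\otimes w_k)=\sum_{p=1}^{k-1}\sum_{\sigma\in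 Sh(p,k-p-1)}\epsilon(\sigma)(w_{\sigma(1)}\otimes\cdots\otimes w_{\sigma(p)})\otimes(w_{\sigma(p+1)}\otimes\cdots\otimes w_{\sigma(k-1)}\otimes w_k)$ is denoted $T^Z(W)$. A family of maps $Q_k:W^{\otimes k}\to W$ of degree $|Q|$ determines the coderivation $Q(w_1\otimes\cdots\otimes w_n)=\sum_{k=1}^n\sum_{i=0}^{n-k}\sum_{\sigma\in Sh(i,k-1)}(-1)^{|Q|(|w_{\sigma(1)}|+\cdots+|w_{\sigma(i)}|)}\epsilon(\sigma)\,w_{\sigma(1)}\otimes\cdots\otimes w_{\sigma(i)}\otimes Q_k(w_{\sigma(i+1)},\dots,w_{\sigma(i+k-1)},w_{i+k})\otimes w_{i+k+1}\otimes\cdots\otimes w_n$ of $T^Z(W)$, and every coderivation arises this way. A Loday $\infty$-algebra is a graded space $W$ with a degree $+1$ coderivation of $T^Z(W)$ squaring to zero. *)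

(* Defs.v *)
From HB Require Import structures.
From mathcomp Require Import all_boot all_order all_algebra.
Set Implicit Arguments. Unset Strict Implicit. Unset Printing Implicit Defensive.
Import Order.TTheory GRing.Theory Num.Theory.
Local Open Scope ring_scope.

Section Defs.
Variable K : numFieldType.

Definition ksgn (e : int) : K := if odd (absz e) then -1 else 1.

(** A homogeneous element of a graded space is represented as a pair
    (degree, vector); a monomial v_1 ... v_k of S^k(V) or a tensor
    w_1 (x) ... (x) w_k is represented by the list of its homogeneous factors. *)
Definition dsum (T : Type) (s : seq (int * T)) : int := \sum_(p <- s) p.1.

Fixpoint homs (T : Type) (h : int -> T -> Prop) (s : seq (int * T)) : Prop :=
  if s is p :: s' then h p.1 p.2 /\ homs h s' else True.

Definition is_grading (V : lmodType K) (h : int -> V -> Prop) : Prop :=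
  [/\ forall d, h d 0,
      forall d (a : K) (u v : V), h d u -> h d v -> h d (a *: u + v),
      forall d e (v : V), d != e -> h d v -> h e v -> v = 0 &
      forall v : V, exists s : seq (int * V), homs h s /\ v = \sum_(p <- s) p.2].

(** Multilinear, graded-symmetric (Koszul) maps on homogeneous lists,
    i.e. maps S^k(V) -> W for every k. *)
Definition sym_multilin (V W : lmodType K) (h : int -> V -> Prop)
  (f : seq (int * V) -> W) : Prop :=
  (forall s1 s2 d (a : K) (u v : V), homs h s1 -> homs h s2 -> h d u -> h d v ->
     f (s1 ++ (d, a *: u + v) :: s2) = a *: f (s1 ++ (d, u) :: s2) + f (s1 ++ (d, v) :: s2))
  /\
  (forall s1 s2 d e (u v : V), homs h s1 -> homs h s2 -> h d u -> h e v ->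
     f (s1 ++ (d, u) :: (e, v) :: s2) = ksgn (d * e) *: f (s1 ++ (e, v) :: (d, u) :: s2)).

Definition has_degree (V : lmodType K) (h : int -> V -> Prop) (e : int)
  (f : seq (int * V) -> V) : Prop :=
  forall s, homs h s -> h (dsum s + e) (f s).

(** all bitmasks of length n; a mask b of the list s encodes the unshuffle
    putting (mask b s) first and (mask (map negb b) s) second. *)
Fixpoint masks (n : nat) : seq bitseq :=
  if n is n'.+1 then [seq true :: b | b <- masks n'] ++ [seq false :: b | b <- masks n']
  else [:: [::]].

Fixpoint ush_exp (T : Type) (acc : int) (b : bitseq) (s : seq (int * T)) : int :=
  match b, s with
  | c :: b', p :: s' =>
      if c then p.1 * acc + ush_exp acc b' s' else ush_exp (acc + p.1) b' s'
  | _, _ => 0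
  end.

Definition ush_sign (T : Type) (b : bitseq) (s : seq (int * T)) : K :=
  ksgn (ush_exp 0 b s).

(** For coderivations P, Q of (S(V), Delta^c) given by their components
    (P, Q : lists of homogeneous elements -> V) with Q of degree dQ,
    pcomp P Q dQ s = p (P (Q (v_1 ... v_n))), where s = [v_1; ...; v_n]. *)
Definition pcomp (V : lmodType K) (P Q : seq (int * V) -> V) (dQ : int)
  (s : seq (int * V)) : V :=
  \sum_(b <- masks (size s) | (0 < count id b)%N)
     ush_sign b s *: P ((dsum (mask b s) + dQ, Q (mask b s)) :: mask (map negb b) s).

(** Component of the bracket [Q,P] of Coder(S(V))[1], where a, b are the
    degrees of Q, P in Coder(S(V))[1] (coderivation degree minus one):
    [Q,P] = (-1)^(a+1) (Q o P - (-1)^((a+1)(b+1)) P o Q). *)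
Definition pbr (V : lmodType K) (Q : seq (int * V) -> V) (a : int)
  (P : seq (int * V) -> V) (b : int) (s : seq (int * V)) : V :=
  ksgn (a + 1) *: (pcomp Q P (b + 1) s - ksgn ((a + 1) * (b + 1)) *: pcomp P Q (a + 1) s).

(** Lie infinity algebra (shifted convention): brackets m_k of degree +1,
    graded symmetric, with M_V^2 = 0, i.e. p o M_V o M_V = 0 on every S^n(V). *)
Definition is_LieInf (V : lmodType K) (h : int -> V -> Prop)
  (m : seq (int * V) -> V) : Prop :=
  [/\ is_grading h, sym_multilin h m, has_degree h 1 m &
      forall s, homs h s -> (0 < size s)%N -> pcomp m m 1 s = 0].

(** Lie infinity action Phi of (E,l) on (V,m): phi x v = Phi^{k,n}(x; v).
    Phi is a Lie infinity morphism from E into (Coder(S(V))[1], d_{M_V}, [,]);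
    the morphism equation  p_L o F o M_E = p_L o M_L o F  is evaluated on the
    component of the coderivations at every w in S^n(V). *)
Definition is_LieInf_action (E V : lmodType K) (hE : int -> E -> Prop)
  (hV : int -> V -> Prop) (l : seq (int * E) -> E) (m : seq (int * V) -> V)
  (phi : seq (int * E) -> seq (int * V) -> V) : Prop :=
  [/\ forall x w, homs hE x -> homs hV w -> hV (dsum x + dsum w + 1) (phi x w),
      forall x, homs hE x -> sym_multilin hV (phi x),
      forall w, homs hV w -> sym_multilin hE (fun x => phi x w) &
      forall x w, homs hE x -> homs hV w -> (0 < size x)%N -> (0 < size w)%N ->
        \sum_(b <- masks (size x) | (0 < count id b)%N)
            ush_sign b x *:
              phi ((dsum (mask b x) + 1, l (mask b x)) :: mask (map negb b) x) w
        = - pcomp m (phi x) (dsum x + 1) w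
          + ksgn (dsum x + 1) *: pcomp (phi x) m 1 w
          + 2^-1 *: \sum_(b <- masks (size x) | (0 < count id b < size x)%N)
              ush_sign b x *:
                pbr (phi (mask b x)) (dsum (mask b x))
                    (phi (mask (map negb b) x)) (dsum (mask (map negb b) x)) w].

(** Coherence: [ad_v, Phi_x] = 0 and [Phi_{y;v}, Phi_x] = 0 (as coderivations,
    i.e. all their components vanish), for monomials x, y in S(E), v in S(V). *)
Definition coherent (E V : lmodType K) (hE : int -> E -> Prop)
  (hV : int -> V -> Prop) (m : seq (int * V) -> V)
  (phi : seq (int * E) -> seq (int * V) -> V) : Prop :=
  forall x y v w, homs hE x -> homs hE y -> homs hV v -> homs hV w ->
    (0 < size x)%N -> (0 < size y)%N -> (0 < size v)%N -> (0 < size w)%N ->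
    pbr (fun u => m (v ++ u)) (dsum v) (phi x) (dsum x) w = 0 /\
    pbr (fun u => phi y (v ++ u)) (dsum y + dsum v) (phi x) (dsum x) w = 0.

Definition hsum (E V : lmodType K) (hE : int -> E -> Prop) (hV : int -> V -> Prop)
  (d : int) (w : E * V) : Prop := hE d w.1 /\ hV d w.2.

Definition lfrak (E V : lmodType K) (l : seq (int * E) -> E) (m : seq (int * V) -> V)
  (phi : seq (int * E) -> seq (int * V) -> V) (s : seq (int * (E * V))) : E * V :=
  let sx := [seq (p.1, p.2.1) | p <- s] in
  let sv := [seq (p.1, p.2.2) | p <- s] in
  (l sx, \sum_(1 <= i < size s) phi (take i sx) (drop i sv) + m sv).

(** For the coderivation Q of T^Z(W) of degree +1 with components Q_k,
    pcompZ Q s = p (Q (Q (w_1 (x) ... (x) w_n))), s = [w_1; ...; w_n]: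
    sum over k, i and sigma in Sh(i,k-1) (j = i+k-1 below) of
    (-1)^(|Q|(|w_s1|+..+|w_si|)) eps(sigma)
      Q_{n-k+1}(w_s1,..,w_si, Q_k(w_s(i+1),..,w_s(i+k-1), w_(i+k)), w_(i+k+1),..,w_n). *)
Definition pcompZ (W : lmodType K) (Q : seq (int * W) -> W) (s : seq (int * W)) : W :=
  \sum_(j < size s)
    let pre := take j s in
    if drop j s is wj :: suf then
      \sum_(b <- masks (size pre))
        (ksgn (dsum (mask b pre)) * ush_sign b pre) *:
          Q (mask b pre ++
             (dsum (mask (map negb b) pre) + wj.1 + 1,
              Q (rcons (mask (map negb b) pre) wj)) :: suf)
    else 0.

(** Loday infinity algebra: the degree +1 coderivation of T^Z(W) with
    components Q squares to zero, i.e. p o Q o Q = 0 on every W^(x)n. *)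
Definition is_LodayInf (W : lmodType K) (h : int -> W -> Prop)
  (Q : seq (int * W) -> W) : Prop :=
  forall s, homs h s -> (0 < size s)%N -> pcompZ Q s = 0.

End Defs.

(* Main.v *)
From HB Require Import structures.
Require Import Defs.
From mathcomp Require Import all_boot all_order all_algebra.
From mathcomp Require Import zify.
Set Implicit Arguments. Unset Strict Implicit. Unset Printing Implicit Defensive.
Import GRing.Theory Num.Theory.
Local Open Scope ring_scope.

(** By multilinearity it is enough to square the coderivation on words whose
    letters lie in E or in V.  On a word of the form E^p V^q the square is the
    defect of the identity for l, of the identity for m, or of the morphism
    equation of Phi.  Any other word reads x u w, where x is in E^p, w in V^t,
    and u begins in V and ends in E; let v' and x' be the subwords of the letters
    of u in V and in E.  A bracket vanishes as soon as a letter of V precedes a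
    letter of E, so in every surviving term u is split into v' and x', and the
    square on x u w is, up to signs, the sum of [Phi_{x_B; v'}, Phi_{x_A x'}](w)
    over the unshuffles (x_A, x_B) of x, where Phi_{1; v'} = ad_{v'}.  Coherence
    kills each of these brackets; conversely, induction on p extracts each bracket
    from the vanishing of the sums. *)

(** * Parities of degrees and Koszul signs *)

Section Signs.
Variable K : numFieldType.

Definition oddz (e : int) : bool := odd (absz e).

Lemma oddzD a b : oddz (a + b) = oddz a (+) oddz b.
Proof. rewrite /oddz; lia. Qed.

Lemma oddzM a b : oddz (a * b) = oddz a && oddz b.
Proof. by rewrite /oddz abszM oddM. Qed.

Lemma oddz0 : oddz 0 = false. Proof. by []. Qed.

Lemma oddz1 : oddz 1 = true. Proof. by []. Qed.

Lemma ksgnD a b : ksgn K (a + b) = ksgn K a * ksgn K b.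
Proof.
rewrite /ksgn -!/(oddz _) oddzD.
by case: (oddz a); case: (oddz b); rewrite ?mulrNN ?mulr1 ?mul1r.
Qed.

Lemma eq_ksgn a b : oddz a = oddz b -> ksgn K a = ksgn K b.
Proof. by rewrite /ksgn -!/(oddz _) => ->. Qed.

Lemma ksgnS a : ksgn K (a + 1) = - ksgn K a.
Proof. by rewrite ksgnD mulrN1. Qed.

End Signs.

(** A Koszul sign depends only on degrees modulo 2, so an identity between products of signs becomes
    a boolean identity in the parities, decided by cases. *)
Ltac parity :=
  rewrite -?ksgnD; apply: eq_ksgn; rewrite ?(oddzD, oddzM, oddz1, oddz0);
  repeat match goal with |- context [oddz ?e] => case: (oddz e) end; done.

(** * Words of homogeneous letters and the order of their letters *)

Section Homs.
Variable T : Type.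
Implicit Types (s : seq (int * T)) (h : int -> T -> Prop).

Lemma dsum_nil : dsum ([::] : seq (int * T)) = 0.
Proof. exact: big_nil. Qed.

Lemma dsum_cons p s : dsum (p :: s) = p.1 + dsum s.
Proof. exact: big_cons. Qed.

Lemma dsum_cat s1 s2 : dsum (s1 ++ s2) = dsum s1 + dsum s2.
Proof. exact: big_cat. Qed.

Lemma dsum_rcons s p : dsum (rcons s p) = dsum s + p.1.
Proof. by rewrite -cats1 dsum_cat dsum_cons dsum_nil addr0. Qed.

Lemma dsum_map T' (f : int * T -> int * T') s :
  (forall p, (f p).1 = p.1) -> dsum (map f s) = dsum s.
Proof. by move=> fE; rewrite /dsum big_map; apply: eq_bigr => p _. Qed.

Lemma homs_cat h s1 s2 : homs h (s1 ++ s2) <-> homs h s1 /\ homs h s2.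
Proof. by elim: s1 => [|p s1 IH] /=; tauto. Qed.

Lemma homs_rcons h s p : homs h (rcons s p) <-> homs h s /\ h p.1 p.2.
Proof. by rewrite -cats1 homs_cat /=; tauto. Qed.

Lemma homs_map T' (h' : int -> T' -> Prop) h (f : int * T -> int * T') s :
  (forall p, h p.1 p.2 -> h' (f p).1 (f p).2) -> homs h s -> homs h' (map f s).
Proof. by move=> hf; elim: s => //= p s IH [/hf ? /IH]. Qed.

Lemma has_split (a : pred (int * T)) s :
  has a s -> exists s1 p s2, s = s1 ++ p :: s2 /\ a p.
Proof.
elim: s => //= p s IH; case ap: (a p) => /=; first by exists [::], p, s.
by case/IH=> s1 [q [s2 [-> aq]]]; exists (p :: s1), q, s2.
Qed.

Fixpoint before (a b : pred (int * T)) s :=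
  if s is p :: s' then a p && has b s' || before a b s' else false.

Lemma before_cat a b s1 s2 :
  before a b (s1 ++ s2) = [|| before a b s1, before a b s2 | has a s1 && has b s2].
Proof.
elim: s1 => [|p s1 IH] /=; first by rewrite orbF.
rewrite IH has_cat.
by case: (a p) (has b s1) (has a s1) (has b s2) => [] [] [] [] /=; rewrite ?orbF ?orbT.
Qed.

Lemma before_split a b s : before a b s ->
  exists s1 p s2 q s3, [/\ s = s1 ++ p :: s2 ++ q :: s3, a p & b q].
Proof.
elim: s => //= p s IH /orP[/andP[ap /has_split [s2 [q [s3 [-> bq]]]]]|].
  by exists [::], p, s2, q, s3.
case/IH=> s1 [p' [s2 [q [s3 [-> ap bq]]]]].
by exists (p :: s1), p', s2, q, s3.
Qed.

End Homs.

(** * Sums over unshuffles and over decompositions of a word *)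

Section Shuffles.
Variable K : numFieldType.

Section ShuffleSum.
Variables (T : Type) (W : lmodType K).
Implicit Types (s A B : seq (int * T)) (G : seq (int * T) -> seq (int * T) -> W).

(* The sum of [eps(A, B) *: G A B] over all unshuffles [(A, B)] of the word [s]. *)
Definition shf G s : W :=
  \sum_(b <- masks (size s)) ush_sign K b s *: G (mask b s) (mask (map negb b) s).

(** The accumulator is the total degree of the letters already sent to the second block, and each
    later letter of the first block crosses all of them. *)
Lemma ush_exp_acc acc b s :
  ush_exp acc b s = acc * dsum (mask b s) + ush_exp 0 b s.
Proof.
elim: b s acc => [|c b IH] [|p s] acc; rewrite ?mask0 /= ?dsum_nil ?mulr0 //.
case: c => /=.
  by rewrite IH dsum_cons [in RHS]mulrDr add0r [p.1 * acc]mulrC addrA.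
by rewrite IH [in RHS]IH add0r mulrDl addrA.
Qed.

Lemma eq_shf G G' s : (forall A B, G A B = G' A B) -> shf G s = shf G' s.
Proof. by move=> eqG; apply: eq_bigr => b _; rewrite eqG. Qed.

Lemma shf_nil G : shf G [::] = G [::] [::].
Proof. by rewrite /shf big_cons big_nil addr0 scale1r. Qed.

(** The first letter crosses nothing when it opens [A], and all of [A] when it opens [B]. Inductions
    on words use this recursion in place of bitmasks. *)
Lemma shf_cons G p s :
  shf G (p :: s) = shf (fun A B => G (p :: A) B) s
                 + shf (fun A B => ksgn K (p.1 * dsum A) *: G A (p :: B)) s.
Proof.
rewrite /shf /= big_cat !big_map /=; congr (_ + _); apply: eq_bigr => b _.
  by rewrite /ush_sign /= mulr0 add0r.
by rewrite /ush_sign /= ush_exp_acc add0r ksgnD mulrC scalerA.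
Qed.

Lemma shfD G G' s : shf (fun A B => G A B + G' A B) s = shf G s + shf G' s.
Proof. by rewrite /shf -big_split; apply: eq_bigr => b _; rewrite scalerDr. Qed.

Lemma shfZ c G s : shf (fun A B => c *: G A B) s = c *: shf G s.
Proof.
by rewrite /shf scaler_sumr; apply: eq_bigr => b _; rewrite !scalerA mulrC.
Qed.

Lemma shf0 s : shf (fun _ _ => 0) s = 0.
Proof. by rewrite /shf big1 // => b _; rewrite scaler0. Qed.

(** Unshuffling the two pieces separately leaves the order [A1 B1 A2 B2]; the extra sign moves [A2]
    across [B1]. *)
Lemma shf_cat G s1 s2 :
  shf G (s1 ++ s2) =
  shf (fun A1 B1 => shf (fun A2 B2 =>
    ksgn K (dsum B1 * dsum A2) *: G (A1 ++ A2) (B1 ++ B2)) s2) s1.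
Proof.
elim: s1 G => [|p s1 IH] G.
  rewrite shf_nil; apply: eq_shf => A B.
  by rewrite dsum_nil mul0r scale1r.
rewrite cat_cons !shf_cons !IH; congr (_ + _); apply: eq_shf => A B.
rewrite -shfZ; apply: eq_shf => A' B'; rewrite !scalerA dsum_cat dsum_cons.
by congr (_ *: _); parity.
Qed.

Lemma shf_rcons G s z :
  shf G (rcons s z) = shf (fun A B => ksgn K (dsum B * z.1) *: G (rcons A z) B) s
                    + shf (fun A B => G A (rcons B z)) s.
Proof.
rewrite -cats1 shf_cat -shfD; apply: eq_shf => A B.
by rewrite shf_cons !shf_nil dsum_cons !dsum_nil addr0 !mulr0 !scale1r !cats0 !cats1.
Qed.

Lemma shf_swap G s : shf G s = shf (fun A B => ksgn K (dsum A * dsum B) *: G B A) s.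
Proof.
elim: s G => [|p s IH] G; first by rewrite !shf_nil dsum_nil scale1r.
rewrite !shf_cons addrC IH; congr (_ + _).
  apply: eq_shf => A B; rewrite !scalerA -ksgnD dsum_cons.
  by rewrite mulrDl addrC.
rewrite IH; apply: eq_shf => A B; rewrite scalerA -ksgnD dsum_cons; congr (_ *: _).
parity.
Qed.

(** The structure maps are controlled on homogeneous words only, so extensionality has to provide
    the homogeneity of both blocks, along with their sizes and degrees. *)
Lemma eq_shf_homs h G G' s : homs h s ->
  (forall A B, homs h A -> homs h B -> (size A + size B = size s)%N ->
     dsum A + dsum B = dsum s -> G A B = G' A B) ->
  shf G s = shf G' s.
Proof.
elim: s G G' => [|p s IH] G G' /=.
  by move=> _ eqG; rewrite !shf_nil eqG // ?dsum_nil.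
move=> [hp hs] eqG; rewrite !shf_cons.
congr (_ + _); apply: IH => // A B hA hB sAB dAB; rewrite eqG //= ?dsum_cons.
- by rewrite addSn sAB.
- by rewrite -addrA dAB.
- by rewrite addnS sAB.
- by rewrite addrCA dAB.
Qed.

Lemma shf0_homs h G s : homs h s ->
  (forall A B, homs h A -> homs h B -> (size A + size B = size s)%N -> G A B = 0) ->
  shf G s = 0.
Proof. by move=> hs G0; rewrite -(shf0 s); apply: (eq_shf_homs hs) => *; apply: G0. Qed.

(** Every letter of [s] lands in one of the two blocks, in particular a letter satisfying [a]. *)
Lemma shf0_has h (a : pred (int * T)) G s : homs h s -> has a s ->
  (forall A B, homs h A -> homs h B -> has a A || has a B -> G A B = 0) ->
  shf G s = 0.
Proof.
elim: s G => //= p s IH G [hp hs] aps G0; rewrite shf_cons; case ap: (a p) aps => /= as_.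
  rewrite !(shf0_homs hs) ?addr0 // => A B hA hB _; rewrite G0 ?scaler0 //= ap ?orbT //.
rewrite !IH ?addr0 // => A B hA hB aAB; rewrite G0 ?scaler0 //= ap //.
Qed.

Lemma shf_left_nil h G s : homs h s ->
  (forall A B, homs h A -> homs h B -> (size A + size B = size s)%N ->
    (0 < size A)%N -> G A B = 0) ->
  shf G s = G [::] s.
Proof.
elim: s G => [|p s IH] G /=; first by rewrite shf_nil.
move=> [hp hs] G0; rewrite shf_cons (shf0_homs hs) ?add0r => [|A B *]; last first.
  by apply: G0 => //=; rewrite addSn; congr S.
rewrite IH // ?dsum_nil ?mulr0 ?scale1r // => A B *.
by rewrite G0 ?scaler0 //= addnS; congr S.
Qed.

Lemma shf_ends h G s :
  homs h s -> (0 < size s)%N ->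
  shf G s = shf (fun A B => if nilp A || nilp B then 0 else G A B) s
            + G [::] s + G s [::].
Proof.
move=> hs s_gt0.
have -> : G [::] s = shf (fun A B => if nilp A then G A B else 0) s.
  by rewrite (shf_left_nil hs) // => -[].
have -> : G s [::] = shf (fun A B => if nilp B then G A B else 0) s.
  rewrite shf_swap (shf_left_nil hs) ?dsum_nil ?mul0r ?scale1r // => -[|p A] B _ _ _ //= _.
  by rewrite scaler0.
rewrite -!shfD; apply: (eq_shf_homs hs) => -[|p A] [|q B] _ _ /=; rewrite ?addr0 ?add0r //.
by move=> s0; rewrite -s0 in s_gt0.
Qed.

Lemma sum_masks_mkcond (P : nat -> bool) G s :
  \sum_(b <- masks (size s) | P (count id b))
     ush_sign K b s *: G (mask b s) (mask (map negb b) s) =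
  shf (fun A B => if P (size A) then G A B else 0) s.
Proof.
(* The count of a mask is the size of the first block only if the mask is as long as the word. *)
rewrite /shf big_mkcond; suff: all (fun b => size b == size s) (masks (size s)).
  elim: (masks _) => [|b bs IH]; rewrite ?big_nil //= !big_cons => /andP[/eqP sb sbs].
  by rewrite IH // size_mask //; case: (P _); rewrite ?scaler0.
elim: (size s) => //= n IH; rewrite all_cat !all_map.
by apply/andP; split; apply: sub_all IH => b.
Qed.

(* The sum of [F pre w suf] over all decompositions [s = pre ++ w :: suf]. *)
Definition zsum (F : seq (int * T) -> int * T -> seq (int * T) -> W) s : W :=
  \sum_(j < size s)
    if drop j s is w :: suf then F (take j s) w suf else 0.

Lemma zsum_nil F : zsum F [::] = 0.
Proof. by rewrite /zsum big_ord0. Qed.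

Lemma zsum_cons F p s : zsum F (p :: s) = F [::] p s + zsum (fun pre => F (p :: pre)) s.
Proof. by rewrite /zsum big_ord_recl. Qed.

Lemma zsum_cat F s1 s2 :
  zsum F (s1 ++ s2) = zsum (fun pre w suf => F pre w (suf ++ s2)) s1
                    + zsum (fun pre => F (s1 ++ pre)) s2.
Proof.
elim: s1 F => [|p s1 IH] F; first by rewrite zsum_nil add0r.
by rewrite /= !zsum_cons IH addrA.
Qed.

Lemma zsum_rcons F s z :
  zsum F (rcons s z) = zsum (fun pre w suf => F pre w (rcons suf z)) s + F s z [::].
Proof.
rewrite -cats1 zsum_cat zsum_cons zsum_nil addr0 cats0; congr (_ + _).
by apply: eq_bigr => j _; case: (drop j s) => // w suf; rewrite cats1.
Qed.

Lemma eq_zsum F F' s :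
  (forall pre w suf, s = pre ++ w :: suf -> F pre w suf = F' pre w suf) ->
  zsum F s = zsum F' s.
Proof.
elim: s F F' => [|p s IH] F F' eqF; first by rewrite !zsum_nil.
rewrite !zsum_cons eqF //; congr (_ + _); apply: IH => pre w suf s_eq.
by rewrite eqF // s_eq.
Qed.

Lemma zsum0 F s :
  (forall pre w suf, s = pre ++ w :: suf -> F pre w suf = 0) -> zsum F s = 0.
Proof.
move=> F0; rewrite (@eq_zsum F (fun _ _ _ => 0)) // /zsum big1 // => j _.
by case: drop.
Qed.

Lemma zsumD F F' s :
  zsum (fun pre w suf => F pre w suf + F' pre w suf) s = zsum F s + zsum F' s.
Proof.
rewrite /zsum -big_split; apply: eq_bigr => j _.
by case: (drop j s) => [|w suf] /=; rewrite ?addr0.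
Qed.

Lemma zsumZ c F s : zsum (fun pre w suf => c *: F pre w suf) s = c *: zsum F s.
Proof. by rewrite /zsum scaler_sumr; apply: eq_bigr => j _; case: drop; rewrite ?scaler0. Qed.

End ShuffleSum.

Section Maps.
Variables (T T' : Type) (W W' : lmodType K) (f : int * T -> int * T').
Hypothesis fE : forall p, (f p).1 = p.1.

Lemma shf_map (G : seq (int * T') -> seq (int * T') -> W) s :
  shf G (map f s) = shf (fun A B => G (map f A) (map f B)) s.
Proof.
elim: s G => [|p s IH] G; first by rewrite !shf_nil.
rewrite /= !shf_cons !IH; congr (_ + _).
by apply: eq_shf => A B; rewrite fE dsum_map.
Qed.

Lemma zsum_map (F : seq (int * T') -> int * T' -> seq (int * T') -> W) s :
  zsum F (map f s) = zsum (fun pre w suf => F (map f pre) (f w) (map f suf)) s.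
Proof.
elim: s F => [|p s IH] F; first by rewrite !zsum_nil.
by rewrite /= !zsum_cons IH.
Qed.

Lemma shf_linear (g : {linear W -> W'}) (G : seq (int * T) -> seq (int * T) -> W) s :
  shf (fun A B => g (G A B)) s = g (shf G s).
Proof. by rewrite /shf linear_sum; apply: eq_bigr => b _; rewrite linearZ. Qed.

Lemma zsum_linear (g : {linear W -> W'})
    (F : seq (int * T) -> int * T -> seq (int * T) -> W) s :
  zsum (fun pre w suf => g (F pre w suf)) s = g (zsum F s).
Proof.
by rewrite /zsum linear_sum; apply: eq_bigr => j _; case: drop; rewrite ?linear0.
Qed.

Lemma zsum_shf (F : seq (int * T) -> int * T -> seq (int * T) ->
    seq (int * T') -> seq (int * T') -> W) s s' :
  zsum (fun pre w suf => shf (F pre w suf) s') s =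
  shf (fun A B => zsum (fun pre w suf => F pre w suf A B) s) s'.
Proof.
elim: s F => [|p s IH] F.
  by rewrite zsum_nil -[LHS](shf0 _ s'); apply: eq_shf => A B; rewrite zsum_nil.
by rewrite zsum_cons IH -shfD; apply: eq_shf => A B; rewrite zsum_cons.
Qed.

End Maps.

(** * Composition of coderivations, symmetric and Zinbiel *)

Section Insertion.
Variables (T : Type) (W : lmodType K) (h : int -> T -> Prop).
Implicit Types (P : seq (int * T) -> W) (Q : seq (int * T) -> T).

(** Symmetry is separated from multilinearity because the induction in [ins_zsum] replaces [P] by
    [fun t => P (rcons t z)] and carries symmetry alone. *)
Definition gsymmetric P :=
  forall s1 s2 d e (u v : T), homs h s1 -> homs h s2 -> h d u -> h e v ->
     P (s1 ++ (d, u) :: (e, v) :: s2) = ksgn K (d * e) *: P (s1 ++ (e, v) :: (d, u) :: s2).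

Lemma gsymmetric_front P A d u s : gsymmetric P -> homs h A -> homs h s -> h d u ->
  P (A ++ (d, u) :: s) = ksgn K (d * dsum A) *: P ((d, u) :: A ++ s).
Proof.
move=> symP hA hs hu.
suff H s1 : homs h s1 ->
    P (s1 ++ A ++ (d, u) :: s) = ksgn K (d * dsum A) *: P (s1 ++ (d, u) :: A ++ s).
  exact: (H [::]).
elim: A s1 hA => [|[e v] A IH] s1 /=; first by rewrite dsum_nil mulr0 scale1r.
move=> [hv hA] hs1; have := IH (rcons s1 (e, v)) hA; rewrite !cat_rcons => ->; last first.
  by rewrite homs_rcons.
rewrite (symP s1) ?homs_cat // scalerA -ksgnD dsum_cons; congr (_ *: _).
parity.
Qed.

Definition ins P Q (dQ : int) s : W :=
  shf (fun A B => if nilp A then 0 else P ((dsum A + dQ, Q A) :: B)) s.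

(* Group the unshuffles by the last letter that goes into [Q]: graded symmetry of [P] turns
   the coderivation formula on S(V) into the Zinbiel one. *)
Lemma ins_zsum P Q dQ s : gsymmetric P ->
  (forall t, homs h t -> (0 < size t)%N -> h (dsum t + dQ) (Q t)) -> homs h s ->
  ins P Q dQ s =
  zsum (fun pre w suf => shf (fun A B =>
    ksgn K (dQ * dsum A) *:
      P (A ++ (dsum B + w.1 + dQ, Q (rcons B w)) :: suf)) pre) s.
Proof.
move=> symP hQ; elim/last_ind: s P symP => [|s z IH] P symP.
  by rewrite /ins shf_nil zsum_nil.
rewrite homs_rcons => -[hs hz]; rewrite /ins shf_rcons zsum_rcons addrC; congr (_ + _).
  rewrite -/(ins (fun t => P (rcons t z)) Q dQ s) IH //.
    apply: eq_zsum => pre w suf _; apply: eq_shf => A B.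
    by rewrite rcons_cat.
  move=> s1 s2 d e u v h1 h2 hu hv; rewrite !rcons_cat /=.
  by apply: symP => //; rewrite homs_rcons.
rewrite [RHS]shf_swap; apply: (eq_shf_homs hs) => A B hA hB _ _.
have hr : h (dsum A + z.1 + dQ) (Q (rcons A z)).
  by rewrite -dsum_rcons; apply: hQ; rewrite ?homs_rcons ?size_rcons.
rewrite (gsymmetric_front symP) // cats0 !scalerA -!ksgnD dsum_rcons.
have -> : nilp (rcons A z) = false by rewrite /nilp size_rcons.
by congr (_ *: _); parity.
Qed.

End Insertion.

Lemma pcompE (U : lmodType K) (P Q : seq (int * U) -> U) (dQ : int) (s : seq (int * U)) :
  Defs.pcomp P Q dQ s = ins P Q dQ s.
Proof.
rewrite /Defs.pcomp (sum_masks_mkcond (fun n => 0 < n)%N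
  (fun A B => P ((dsum A + dQ, Q A) :: B))).
by apply: eq_shf => -[].
Qed.

End Shuffles.

(** * Multilinear maps and gradings *)

Section Multilinear.
Variables (K : numFieldType) (U W : lmodType K) (h : int -> U -> Prop).

Lemma homs_take i (s : seq (int * U)) : homs h s -> homs h (take i s).
Proof. by rewrite -{1}(cat_take_drop i s) homs_cat => -[]. Qed.

Lemma homs_drop i (s : seq (int * U)) : homs h s -> homs h (drop i s).
Proof. by rewrite -{1}(cat_take_drop i s) homs_cat => -[]. Qed.

Lemma multilinD (f : seq (int * U) -> W) s1 s2 d u v : sym_multilin h f ->
  homs h s1 -> homs h s2 -> h d u -> h d v ->
  f (s1 ++ (d, u + v) :: s2) = f (s1 ++ (d, u) :: s2) + f (s1 ++ (d, v) :: s2).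
Proof.
by move=> [f_lin _] *; rewrite -[u in LHS]scale1r f_lin // scale1r.
Qed.

Lemma multilin_gsymmetric (f : seq (int * U) -> W) :
  sym_multilin h f -> gsymmetric h f.
Proof. by case. Qed.

Definition has_zero (s : seq (int * U)) := has (fun p => p.2 == 0) s.

Lemma has_zero_cat s1 s2 : has_zero (s1 ++ s2) = has_zero s1 || has_zero s2.
Proof. exact: has_cat. Qed.

(** Writing the zero letter as [0 + 0] shows that the value equals its own double. *)
Lemma multilin_has_zero (f : seq (int * U) -> W) s :
  sym_multilin h f -> homs h s -> has_zero s -> f s = 0.
Proof.
move=> f_ml hs /has_split [s1 [[d u] [s2 [s_eq /eqP /= u0]]]].
move: hs; rewrite {}s_eq {}u0 homs_cat /= => -[h1 [h0 h2]].
have := multilinD f_ml h1 h2 h0 h0; rewrite addr0 => /esym/eqP.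
by rewrite -subr_eq0 addrK => /eqP.
Qed.

End Multilinear.

Section Gradings.
Variables (K : numFieldType) (U : lmodType K) (h : int -> U -> Prop).
Hypothesis gr : is_grading h.

Lemma grading0 d : h d 0.
Proof. by case: gr. Qed.

Lemma gradingD d u v : h d u -> h d v -> h d (u + v).
Proof. by case: gr => _ lin _ _ hu hv; rewrite -[u]scale1r; apply: lin. Qed.

Lemma grading_sum (I : Type) (r : seq I) (P : pred I) d (F : I -> U) :
  (forall i, P i -> h d (F i)) -> h d (\sum_(i <- r | P i) F i).
Proof. by move=> hF; apply: (big_ind (h d)); [exact: grading0 | exact: gradingD|]. Qed.

End Gradings.

(** * The square of a Zinbiel coderivation *)

Section ZinbielComposition.
Variables (K : numFieldType) (U : lmodType K) (h : int -> U -> Prop).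
Variable Q : seq (int * U) -> U.

Definition zterm (suf : seq (int * U)) w A B : U :=
  ksgn K (dsum A) *: Q (A ++ (dsum B + w.1 + 1, Q (rcons B w)) :: suf).

Lemma pcompZE s :
  pcompZ Q s = zsum (fun pre w suf => shf (zterm suf w) pre) s.
Proof.
apply: eq_bigr => j _; case: (drop j s) => // w suf; apply: eq_bigr => b _.
by rewrite scalerA mulrC.
Qed.

Hypothesis gr : is_grading h.
Hypothesis Q_deg : has_degree h 1 Q.
Hypothesis QD : forall s1 s2 d u v, homs h s1 -> homs h s2 -> h d u -> h d v ->
  Q (s1 ++ (d, u + v) :: s2) = Q (s1 ++ (d, u) :: s2) + Q (s1 ++ (d, v) :: s2).

(** The varied letter follows the last letter of the inner word, is that letter, or precedes it; in
    the third case an unshuffle sends it to the outer or to the inner word. When it is in the inner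
    word, additivity of [Q] is applied twice. *)
Lemma pcompZD s1 s2 d u v : homs h s1 -> homs h s2 -> h d u -> h d v ->
  pcompZ Q (s1 ++ (d, u + v) :: s2)
  = pcompZ Q (s1 ++ (d, u) :: s2) + pcompZ Q (s1 ++ (d, v) :: s2).
Proof.
move=> h1 h2 hu hv; have huv := gradingD gr hu hv.
have hQ B w : homs h B -> h w.1 w.2 -> h (dsum B + w.1 + 1) (Q (rcons B w)).
  by move=> hB hw; rewrite -dsum_rcons; apply: Q_deg; rewrite homs_rcons.
rewrite !pcompZE !zsum_cat !zsum_cons [RHS]addrACA; congr (_ + _).
  rewrite -zsumD; apply: eq_zsum => pre w suf s_eq.
  move: h1; rewrite s_eq homs_cat /= => -[hpre [hw hsuf]].
  rewrite -shfD; apply: (eq_shf_homs hpre) => A B hA hB _ _.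
  rewrite /zterm -!cat_cons !catA QD ?scalerDr // homs_cat /=.
  by do !split=> //; apply: hQ.
rewrite [RHS]addrACA; congr (_ + _).
  rewrite !cats0 -shfD; apply: (eq_shf_homs h1) => A B hA hB _ _.
  rewrite /zterm /= -!cats1 QD // QD ?scalerDr // -?[B ++ _]cats1 ?cats1.
  - exact: (hQ B (d, u)).
  - exact: (hQ B (d, v)).
rewrite -zsumD; apply: eq_zsum => pre w suf s_eq.
move: h2; rewrite s_eq homs_cat /= => -[hpre [hw hsuf]].
rewrite !shf_cat -shfD; apply: (eq_shf_homs h1) => A1 B1 hA1 hB1 _ _.
rewrite !shf_cons [RHS]addrACA.
congr (_ + _); rewrite -shfD; apply: (eq_shf_homs hpre) => A B hA hB _ _; rewrite /zterm /=.
  rewrite !dsum_cat !dsum_cons /= -scalerDr -scalerDr; congr (_ *: (_ *: _)).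
  rewrite -!catA /= QD // homs_cat /=.
  by do !split=> //; rewrite -dsum_cat; apply: hQ => //; rewrite homs_cat.
rewrite !dsum_cat !dsum_cons /= -!scalerDr; congr (_ *: (_ *: (_ *: _))).
rewrite !rcons_cat /= QD // ?homs_rcons //.
have hB1B u' : h d u' -> homs h (B1 ++ (d, u') :: B) by rewrite homs_cat /=.
have degE u' : dsum B1 + (d + dsum B) = dsum (B1 ++ (d, u') :: B).
  by rewrite dsum_cat dsum_cons.
rewrite QD ?homs_cat //.
- by rewrite (degE u) -rcons_cons -rcons_cat; apply/hQ/hw; apply: hB1B.
- by rewrite (degE v) -rcons_cons -rcons_cat; apply/hQ/hw; apply: hB1B.
Qed.

End ZinbielComposition.

(** * The brackets on the direct sum of E and V *)

Section LodayBrackets.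
Variables (K : numFieldType) (E V : lmodType K).
Variables (hE : int -> E -> Prop) (hV : int -> V -> Prop).
Variables (l : seq (int * E) -> E) (m : seq (int * V) -> V)
  (phi : seq (int * E) -> seq (int * V) -> V).
Hypotheses (gE : is_grading hE) (gV : is_grading hV).
Hypotheses (l_ml : sym_multilin hE l) (l_deg : has_degree hE 1 l).
Hypotheses (m_ml : sym_multilin hV m) (m_deg : has_degree hV 1 m).
Hypothesis phi_deg : forall x w, homs hE x -> homs hV w ->
  hV (dsum x + dsum w + 1) (phi x w).
Hypothesis phi_mlr : forall x, homs hE x -> sym_multilin hV (phi x).
Hypothesis phi_mll : forall w, homs hV w -> sym_multilin hE (phi^~ w).

Notation lf := (lfrak l m phi).
Notation hW := (hsum hE hV).

Definition fsts (s : seq (int * (E * V))) := [seq (p.1, p.2.1) | p <- s].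
Definition snds (s : seq (int * (E * V))) := [seq (p.1, p.2.2) | p <- s].

Lemma homs_fsts s : homs hW s -> homs hE (fsts s).
Proof. by apply: homs_map => p []. Qed.

Lemma homs_snds s : homs hW s -> homs hV (snds s).
Proof. by apply: homs_map => p []. Qed.

Lemma is_grading_hsum : is_grading hW.
Proof.
case: gE gV => E0 El Ed Eg [V0 Vl Vd Vg].
split=> [d|d a u v [? ?] [? ?]|d e [x v] de [/= ? ?] [/= ? ?]|[x v]].
- by split.
- by split; [apply: El | apply: Vl].
- by congr (_, _); [apply: Ed de _ _ | apply: Vd de _ _].
have [s [hs ->]] := Eg x; have [t [ht ->]] := Vg v.
exists ([seq (p.1, (p.2, 0)) | p <- s] ++ [seq (p.1, (0, p.2)) | p <- t]); split.
  by rewrite homs_cat; split; [apply: homs_map hs | apply: homs_map ht] => p ?; split.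
rewrite big_cat !big_map /=.
rewrite [LHS]surjective_pairing [RHS]surjective_pairing /=.
by rewrite !raddf_sum /= !big1_eq addr0 add0r.
Qed.

Lemma lfrak_deg : has_degree hW 1 lf.
Proof.
move=> s hs; split => /=.
  rewrite -(@dsum_map _ _ (fun p => (p.1, p.2.1))) //.
  exact/l_deg/homs_fsts.
apply: gradingD => //.
  apply: grading_sum => // i _; rewrite -/(fsts s) -/(snds s).
  rewrite -[s in dsum s](cat_take_drop i) dsum_cat.
  rewrite -(@dsum_map _ _ (fun p => (p.1, p.2.1)) (take i s)) //.
  rewrite -(@dsum_map _ _ (fun p => (p.1, p.2.2)) (drop i s)) //.
  rewrite map_take map_drop; apply: phi_deg.
    exact/homs_take/homs_fsts.
  exact/homs_drop/homs_snds.
rewrite -(@dsum_map _ _ (fun p => (p.1, p.2.2))) //.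
exact/m_deg/homs_snds.
Qed.

Lemma lfrakD s1 s2 d u v : homs hW s1 -> homs hW s2 -> hW d u -> hW d v ->
  lf (s1 ++ (d, u + v) :: s2) = lf (s1 ++ (d, u) :: s2) + lf (s1 ++ (d, v) :: s2).
Proof.
move=> h1 h2 [hu1 hu2] [hv1 hv2].
have [x1 x2] := (homs_fsts h1, homs_fsts h2).
have [w1 w2] := (homs_snds h1, homs_snds h2).
rewrite /lfrak !map_cat /= -!/(fsts _) -!/(snds _).
rewrite (multilinD l_ml) // (multilinD m_ml) //.
rewrite [RHS]/(_ + _) /= /GRing.add /=; congr (_, _).
rewrite [RHS]addrACA; congr (_ + _); rewrite !size_cat /= -big_split /=.
apply: eq_bigr => i _; rewrite !take_cat !drop_cat !size_map.
(* The cut [i] decides whether the varied letter is an argument of [phi] in V or in E; at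
   [i = size s1] it is the first argument in V. *)
case: (ltnP i (size s1)) => [i_lt | i_ge].
  by rewrite (multilinD (phi_mlr _)) //; [apply: homs_take | apply: homs_drop].
case: (i - size s1)%N => [|k] /=.
  by rewrite !cats0 (multilinD (phi_mlr _) (s1 := [::])).
rewrite (multilinD (phi_mll _)) //; first exact: homs_drop.
exact: homs_take.
Qed.

Lemma phi_has_zero i s : homs hW s ->
  has_zero (take i (fsts s)) || has_zero (drop i (snds s)) ->
  phi (take i (fsts s)) (drop i (snds s)) = 0.
Proof.
move=> hs; have hx := homs_take i (homs_fsts hs); have hw := homs_drop i (homs_snds hs).
by case/orP=> z; [apply: (multilin_has_zero (phi_mll hw))|apply: (multilin_has_zero (phi_mlr hx))].
Qed.

(** Letters of V satisfy [noE] and letters of E satisfy [noV]; a zero letter satisfies both. *)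
Definition noE (p : int * (E * V)) := p.2.1 == 0.
Definition noV (p : int * (E * V)) := p.2.2 == 0.

(** Let [p] in V precede [q] in E. Then [p] kills the term of [l] and [q] that of [m]. A cut after
    [p] puts [p] among the arguments of [phi] in E, and any other cut puts [q] among those in V. *)
Lemma lfrak_before s : homs hW s -> before noE noV s -> lf s = 0.
Proof.
move=> hs /before_split [s1 [p [s2 [q [s3 [s_eq /eqP p0 /eqP q0]]]]]].
rewrite /lfrak -/(fsts s) -/(snds s).
have sE : snds s = snds s1 ++ (p.1, p.2.2) :: snds s2 ++ (q.1, 0) :: snds s3.
  by rewrite s_eq /snds !map_cat /= map_cat /= q0.
have fE : fsts s = fsts s1 ++ (p.1, 0) :: fsts (s2 ++ q :: s3).
  by rewrite s_eq /fsts !map_cat /= p0 ?map_cat.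
rewrite (multilin_has_zero l_ml (homs_fsts hs)); last first.
  by rewrite fE has_zero_cat /has_zero /= eqxx orbT.
rewrite (multilin_has_zero m_ml (homs_snds hs)); last first.
  by rewrite sE has_zero_cat -cat1s !has_zero_cat /has_zero /= eqxx !orbT.
rewrite big1 ?addr0 // => i _; apply: phi_has_zero => //.
rewrite fE sE take_cat drop_cat !size_map.
case: ltnP => _; first by rewrite -cat1s !has_zero_cat /has_zero /= eqxx !orbT.
case: (i - _)%N => [|k]; first by
  rewrite drop0 -[_ :: snds _ ++ _]cat1s -[_ :: snds s3]cat1s !has_zero_cat /has_zero /= eqxx !orbT.
by rewrite has_zero_cat /has_zero /= eqxx orbT.
Qed.

Definition iE (p : int * E) : int * (E * V) := (p.1, (p.2, 0)).
Definition iV (p : int * V) : int * (E * V) := (p.1, (0, p.2)).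

Lemma homs_iE s : homs hE s -> homs hW (map iE s).
Proof. by apply: homs_map => p; split=> //; apply: grading0. Qed.

Lemma homs_iV s : homs hV s -> homs hW (map iV s).
Proof. by apply: homs_map => p; split=> //; apply: grading0. Qed.

(* With the convention [Phi_1 = M_V], one has [Phi_{1;v} = ad_v]. *)
Definition phim x w := if nilp x then m w else phi x w.

Lemma lfrak_E x : homs hE x -> (0 < size x)%N -> lf (map iE x) = (l x, 0).
Proof.
case: x => // p x hx _; have hs := homs_iE hx; rewrite /lfrak -/(fsts _) -/(snds _).
have -> : fsts (map iE (p :: x)) = p :: x.
  by rewrite /fsts -map_comp -[RHS]map_id; apply: eq_map => -[].
rewrite (multilin_has_zero m_ml (homs_snds hs)) ?addr0; last by rewrite /has_zero /= eqxx.
congr (_, _); rewrite big_nat_cond big1 // => i /andP[/andP[i_gt0 i_lt] _].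
have := @phi_has_zero i _ hs.
have -> : fsts (map iE (p :: x)) = p :: x.
  by rewrite /fsts -map_comp -[RHS]map_id; apply: eq_map => -[].
apply; apply/orP; right; rewrite size_map in i_lt.
by rewrite /snds -map_comp -map_drop (drop_nth p) //= eqxx.
Qed.

(** Only the cut exactly between [x] and [w] survives, as any other one feeds a zero to [phi]. *)
Lemma lfrak_EV x w : homs hE x -> homs hV w -> (0 < size w)%N ->
  lf (map iE x ++ map iV w) = (0, phim x w).
Proof.
move=> hx hw w_gt0; set s := _ ++ _.
have hs : homs hW s by rewrite homs_cat; split; [apply: homs_iE | apply: homs_iV].
have fE : fsts s = x ++ fsts (map iV w).
  rewrite /fsts map_cat -map_comp; congr (_ ++ _).
  by rewrite -[RHS]map_id; apply: eq_map => -[].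
have sE : snds s = snds (map iE x) ++ w.
  rewrite /snds map_cat -[X in _ ++ X]map_comp; congr (_ ++ _).
  by rewrite -[RHS]map_id; apply: eq_map => -[].
have zE x' : (0 < size x')%N -> has_zero (snds (map iE x')).
  by case: x' => //= p x' _; rewrite /has_zero /= eqxx.
have zV w' : (0 < size w')%N -> has_zero (fsts (map iV w')).
  by case: w' => //= p x' _; rewrite /has_zero /= eqxx.
rewrite /lfrak -/(fsts s) -/(snds s); congr (_, _).
  by apply: (multilin_has_zero l_ml (homs_fsts hs)); rewrite fE has_zero_cat zV ?orbT.
have zero i : i != size x -> phi (take i (fsts s)) (drop i (snds s)) = 0.
  move=> i_neq; apply: phi_has_zero => //; rewrite fE sE take_cat drop_cat !size_map.
  case: ltngtP i_neq => // i_lt _.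
    by rewrite has_zero_cat /snds -!map_drop zE ?orbT // size_drop subn_gt0.
  rewrite has_zero_cat /fsts -!map_take zV ?orbT // size_take.
  by case: ifP => //; rewrite subn_gt0.
(* For empty [x] this cut would be 0, outside the range of the sum, and the term of [m] takes its
   place. *)
rewrite /phim; case: (posnP (size x)) => [/eqP x0|x_gt0].
  rewrite [nilp x]x0 big_nat_cond big1 => [|i /andP[/andP[i_gt0 _] _]].
    by rewrite add0r sE (size0nil (eqP x0)).
  by rewrite zero // (eqP x0) -lt0n.
rewrite /nilp -[_ == _]negbK -lt0n x_gt0 /=.
rewrite (multilin_has_zero m_ml (homs_snds hs)) ?addr0; last first.
  by rewrite sE has_zero_cat zE.
rewrite (bigD1_seq (size x)) ?iota_uniq //=; last first.
  by rewrite mem_index_iota x_gt0 size_cat !size_map -addn1 leq_add2l.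
rewrite big1 ?addr0 => [|i]; last exact: zero.
rewrite fE sE take_size_cat // drop_size_cat ?size_map //.
Qed.

Lemma lfrak_noE s p : homs hW s -> hW p.1 p.2 -> noE p -> (lf (rcons s p)).1 = 0.
Proof.
move=> hs hp /eqP p0; apply: (multilin_has_zero l_ml).
  by apply/homs_fsts; rewrite homs_rcons.
by rewrite map_rcons -cats1 has_zero_cat /has_zero /= p0 eqxx orbT.
Qed.

(** Cuts are strictly below the length, so the last letter is always among the arguments in V, for
    [phi] as for [m]. *)
Lemma lfrak_noV s p : homs hW s -> hW p.1 p.2 -> noV p -> (lf (rcons s p)).2 = 0.
Proof.
move=> hs hp /eqP p0; have hsp : homs hW (rcons s p) by rewrite homs_rcons.
rewrite /lfrak /= -/(fsts _) -/(snds _).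
have sE : snds (rcons s p) = rcons (snds s) (p.1, 0) by rewrite /snds map_rcons p0.
rewrite (multilin_has_zero m_ml (homs_snds hsp)) ?addr0; last first.
  by rewrite sE -cats1 has_zero_cat /has_zero /= eqxx orbT.
rewrite big_nat_cond big1 // => i /andP[/andP[_]]; rewrite size_rcons ltnS => i_le _.
apply: phi_has_zero => //; rewrite sE -[rcons (snds s) _]cats1 drop_cat size_map.
case: ltnP => [_|i_ge]; first by rewrite has_zero_cat /has_zero /= eqxx !orbT.
have -> : i = size s by apply/eqP; rewrite eqn_leq i_le.
by rewrite subnn /has_zero /= eqxx orbT.
Qed.

Lemma lfrak_letter0 s1 s2 d : homs hW s1 -> homs hW s2 -> lf (s1 ++ (d, 0) :: s2) = 0.
Proof.
move=> h1 h2; have h0 : hW d 0 by apply: grading0; apply: is_grading_hsum.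
have := lfrakD h1 h2 h0 h0; rewrite addr0 => /esym/eqP.
by rewrite -subr_eq0 addrK => /eqP.
Qed.

(** As linear maps, the injections commute with signs and with the sums over unshuffles and
    decompositions. *)
Definition injE (x : E) : E * V := (x, 0).
Definition injV (v : V) : E * V := (0, v).

Fact injE_is_linear : linear injE.
Proof. by move=> a x y; congr (_, _); rewrite /= scaler0 addr0. Qed.
HB.instance Definition _ := GRing.isLinear.Build K E (E * V)%type *:%R injE injE_is_linear.

Fact injV_is_linear : linear injV.
Proof. by move=> a x y; congr (_, _); rewrite /= scaler0 addr0. Qed.
HB.instance Definition _ := GRing.isLinear.Build K V (E * V)%type *:%R injV injV_is_linear.

Lemma phim_deg x t : homs hE x -> homs hV t -> hV (dsum t + (dsum x + 1)) (phim x t).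
Proof.
move=> hx ht; rewrite addrA; case: x hx => [|p x] hx.
  by rewrite dsum_nil addr0; apply: m_deg.
by rewrite [dsum t + _]addrC; apply: phi_deg.
Qed.

Lemma phim_ml x : homs hE x -> sym_multilin hV (phim x).
Proof. by case: x => [|p x] hx; [exact: m_ml | exact: phi_mlr]. Qed.

Lemma homs_outer A B w suf : homs hW A -> homs hW B -> hW w.1 w.2 -> homs hW suf ->
  homs hW (A ++ (dsum B + w.1 + 1, lf (rcons B w)) :: suf).
Proof.
move=> hA hB hw hsuf; rewrite homs_cat; do 2!split=> //.
by rewrite -dsum_rcons; apply: lfrak_deg; rewrite homs_rcons.
Qed.

(** * The square on words of the form E^p V^q *)

Lemma dsum_iE s : dsum (map iE s) = dsum s. Proof. exact: dsum_map. Qed.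
Lemma dsum_iV s : dsum (map iV s) = dsum s. Proof. exact: dsum_map. Qed.

Lemma zterm_EV xA A xB B v suf : homs hE xA -> homs hV A -> homs hE xB ->
  homs hV B -> hV v.1 v.2 -> homs hV suf ->
  zterm lf (map iV suf) (iV v) (map iE xA ++ map iV A) (map iE xB ++ map iV B) =
  injV (ksgn K (dsum xA + dsum A) *:
    phim xA (A ++ (dsum xB + dsum B + v.1 + 1, phim xB (rcons B v)) :: suf)).
Proof.
move=> hxA hA hxB hB hv hsuf; rewrite /zterm rcons_cat -map_rcons !dsum_cat !dsum_iE !dsum_iV.
rewrite linearZ /=; congr (_ *: _).
have hBv : homs hV (rcons B v) by rewrite homs_rcons.
rewrite lfrak_EV //; last by rewrite size_rcons.
rewrite -catA -[_ :: map iV suf]/(map iV ((_, _) :: suf)) -map_cat lfrak_EV //.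
  rewrite homs_cat; do 2!split=> //=.
  have := phim_deg hxB hBv; rewrite dsum_rcons addrA.
  by rewrite [dsum xB + _]addrC [dsum B + dsum xB + _]addrAC.
by rewrite size_cat addnS.
Qed.

Lemma zterm_E A B x suf w : homs hE A -> homs hE B -> hE x.1 x.2 -> homs hE suf ->
  homs hV w -> (0 < size w)%N ->
  zterm lf (map iE suf ++ map iV w) (iE x) (map iE A) (map iE B) =
  injV (ksgn K (dsum A) *: phi (A ++ (dsum B + x.1 + 1, l (rcons B x)) :: suf) w).
Proof.
move=> hA hB hx hsuf hw w_gt0; rewrite /zterm -map_rcons !dsum_iE linearZ; congr (_ *: _).
have hBx : homs hE (rcons B x) by rewrite homs_rcons.
rewrite lfrak_E ?size_rcons // -cat_cons -[_ :: map iE suf]/(map iE ((_, _) :: suf)).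
rewrite catA -map_cat lfrak_EV //; first by case: (A).
rewrite homs_cat; do 2!split=> //=.
by rewrite -dsum_rcons; apply: l_deg.
Qed.

Lemma pcompZ_E x : homs hE x -> (0 < size x)%N ->
  pcompZ lf (map iE x) = injE (ins l l 1 x).
Proof.
move=> hx _; rewrite (ins_zsum (h := hE)) //; first last.
- by move=> t ht _; apply: l_deg.
- exact: multilin_gsymmetric.
rewrite pcompZE zsum_map -zsum_linear; apply: eq_zsum => pre p suf s_eq.
move: hx; rewrite s_eq homs_cat /= => -[hpre [hp hsuf]].
rewrite shf_map // -shf_linear; apply: (eq_shf_homs hpre) => A B hA hB _ _.
have hBp : homs hE (rcons B p) by rewrite homs_rcons.
rewrite /zterm -map_rcons !dsum_iE mul1r linearZ; congr (_ *: _).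
rewrite lfrak_E ?size_rcons // -[_ :: map iE suf]/(map iE ((_, _) :: suf)) -map_cat lfrak_E //.
  rewrite homs_cat; do 2!split=> //=.
  by rewrite -dsum_rcons; apply: l_deg.
by rewrite size_cat addnS.
Qed.

(** An inner bracket that ends in [x] is a value of [l] inserted into [phi]. One that ends in [w] is
    a value of [phim] inserted into [phim], with the letters of [x] shared between the two. *)
Lemma pcompZ_EV x w : homs hE x -> homs hV w -> (0 < size w)%N ->
  pcompZ lf (map iE x ++ map iV w) =
  injV (ins (phi^~ w) l 1 x +
        shf (fun A B => ksgn K (dsum A) *: ins (phim A) (phim B) (dsum B + 1) w) x).
Proof.
move=> hx hw w_gt0; rewrite pcompZE zsum_cat linearD; congr (_ + _).
  rewrite (ins_zsum (h := hE)) //; first last.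
  - by move=> t ht _; apply: l_deg.
  - exact/multilin_gsymmetric/phi_mll.
  rewrite zsum_map -zsum_linear; apply: eq_zsum => pre p suf s_eq.
  move: hx; rewrite s_eq homs_cat /= => -[hpre [hp hsuf]].
  rewrite shf_map // -shf_linear; apply: (eq_shf_homs hpre) => A B hA hB _ _.
  by rewrite zterm_E // mul1r.
rewrite zsum_map.
(* The unshuffles of [x] followed by a prefix of [w] are first separated into those of [x] and those
   of the prefix; [zsum_shf] then brings the sum over [x] outside. *)
transitivity (zsum (fun pre v suf => shf (fun xA xB => injV (ksgn K (dsum xA) *:
    shf (fun A B => ksgn K ((dsum xB + 1) * dsum A) *:
      phim xA (A ++ (dsum B + v.1 + (dsum xB + 1), phim xB (rcons B v)) :: suf)) pre)) x) w).
  apply: eq_zsum => pre v suf s_eq.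
  move: hw; rewrite s_eq homs_cat /= => -[hpre [hv hsuf]].
  rewrite shf_cat shf_map //; apply: (eq_shf_homs hx) => xA xB hxA hxB _ _.
  rewrite shf_map // -shfZ -shf_linear; apply: (eq_shf_homs hpre) => A B hA hB _ _.
  rewrite zterm_EV // dsum_iE dsum_iV -linearZ; congr injV.
  rewrite !scalerA; congr (_ *: phim _ (_ ++ (_, _) :: _)); first parity.
  by rewrite [RHS]addrA [dsum xB + _]addrC [dsum B + dsum xB + _]addrAC.
rewrite zsum_shf -shf_linear; apply: (eq_shf_homs hx) => xA xB hxA hxB _ _.
rewrite zsum_linear zsumZ; congr (injV (_ *: _)); rewrite (ins_zsum (h := hV)) //.
  exact/multilin_gsymmetric/phim_ml.
by move=> t ht _; apply: phim_deg.
Qed.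

(** * Mixed words and their unshuffles *)

Implicit Types (u : seq (int * (E + V))).

(* The sum type [E + V] encodes the letters of the direct sum that lie in E or in V. *)
Definition hS d (z : E + V) := match z with inl x => hE d x | inr v => hV d v end.
Definition toE (p : int * E) : int * (E + V) := (p.1, inl p.2).
Definition toV (p : int * V) : int * (E + V) := (p.1, inr p.2).
Definition emb (p : int * (E + V)) : int * (E * V) :=
  match p.2 with inl x => iE (p.1, x) | inr v => iV (p.1, v) end.
Definition isV (p : int * (E + V)) := if p.2 is inr _ then true else false.
Definition isE (p : int * (E + V)) := ~~ isV p.
Definition lefts u := pmap (fun p => if p.2 is inl x then Some (p.1, x) else None) u.
Definition rights u := pmap (fun p => if p.2 is inr v then Some (p.1, v) else None) u.

Lemma emb1 p : (emb p).1 = p.1. Proof. by case: p => d []. Qed.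

Lemma homs_emb u : homs hS u -> homs hW (map emb u).
Proof.
by apply: homs_map => -[d [x|v]] hp; split=> //=; apply: grading0.
Qed.

Lemma homs_lefts u : homs hS u -> homs hE (lefts u).
Proof. by elim: u => [|[d [x|v]] u IH] //= [hp /IH]. Qed.

Lemma homs_rights u : homs hS u -> homs hV (rights u).
Proof. by elim: u => [|[d [x|v]] u IH] //= [hp /IH]. Qed.

Lemma map_emb_toE s : map emb (map toE s) = map iE s.
Proof. by rewrite -map_comp; apply: eq_map. Qed.

Lemma map_emb_toV s : map emb (map toV s) = map iV s.
Proof. by rewrite -map_comp; apply: eq_map. Qed.

Lemma has_emb_noV u : has isE u -> has noV (map emb u).
Proof. by rewrite has_map; apply: sub_has => -[d []] //= v _; rewrite /noV /= eqxx. Qed.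

Lemma before_emb u : before isV isE u -> before noE noV (map emb u).
Proof.
elim: u => //= p u IH /orP[/andP[pV /has_emb_noV ->]|/IH ->]; last by rewrite orbT.
by case: p pV => d []  //= v _; rewrite /noE eqxx.
Qed.

Lemma before_isVE_cons d v u : has isE u -> before isV isE ((d, inr v) :: u).
Proof. by move=> /= ->. Qed.

Lemma before_isVE_rcons d x u : has isV u -> before isV isE (rcons u (d, inl x)).
Proof. by rewrite -cats1 before_cat /= !andbT => ->; rewrite !orbT. Qed.

(** Only the unshuffle with the letters of E in the first block and those of V in the second
    survives. Its sign depends on [u] alone, hence [e] is chosen before [G]. *)
Lemma shf_separate (W : lmodType K) u : homs hS u ->
  exists e, forall G : seq (int * (E + V)) -> seq (int * (E + V)) -> W,
    (forall A B, homs hS A -> homs hS B -> has isV A || has isE B -> G A B = 0) ->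
    shf G u = ksgn K e *: G (map toE (lefts u)) (map toV (rights u)).
Proof.
elim: u => [|[d [x|v]] u IH] /=.
- by exists 0 => G _; rewrite shf_nil scale1r.
- move=> [hx hu]; have [e He] := IH hu; exists e => G G0.
  rewrite shf_cons addrC (shf0_homs hu) => [|A B hA hB _]; last first.
    by rewrite G0 ?scaler0 //= orbT.
  by rewrite add0r He // => A B hA hB AB; apply: G0.
move=> [hv hu]; have [e He] := IH hu; exists (e + d * dsum (lefts u)) => G G0.
rewrite shf_cons (shf0_homs hu) => [|A B hA hB _]; last by rewrite G0.
rewrite add0r He => [|A B hA hB AB]; last by rewrite G0 ?scaler0.
by rewrite scalerA -ksgnD dsum_map.
Qed.

(* The last letter is in E and the first one in V; as they go to different blocks, one block
   must consist of all the letters of E and the other one of all the letters of V. *)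
Lemma shf_mixed (W : lmodType K) u dv v dx x : homs hS u -> hV dv v -> hE dx x ->
  let uE := rcons (lefts u) (dx, x) in let uV := (dv, v) :: rights u in
  exists e, forall G : seq (int * (E + V)) -> seq (int * (E + V)) -> W,
    (forall A B, homs hS A -> homs hS B ->
      before isV isE A || before isV isE B -> G A B = 0) ->
    shf G ((dv, inr v) :: rcons u (dx, inl x)) =
    ksgn K e *: (G (map toE uE) (map toV uV)
                 + ksgn K (dsum uE * dsum uV) *: G (map toV uV) (map toE uE)).
Proof.
move=> hu hv hx uE uV; have [e He] := shf_separate W hu.
exists (e + dsum (rights u) * dx + dv * (dsum (lefts u) + dx)) => G G0.
(* Four sums arise from the blocks chosen for the first and the last letter; the two with both
   letters in the same block vanish. *)
rewrite shf_cons !shf_rcons.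
rewrite (shf0_homs hu) => [|A B hA hB _]; last first.
  rewrite G0 ?scaler0 ?homs_rcons //=; first by rewrite homs_rcons.
  by rewrite -cats1 has_cat /= !orbT.
rewrite add0r addrCA [X in _ + (_ + X)](shf0_homs hu) ?addr0 => [|A B hA hB _]; last first.
  rewrite G0 ?scaler0 ?homs_rcons //=; first by rewrite homs_rcons.
  by rewrite -cats1 has_cat /= !orbT.
rewrite scalerDr; congr (_ + _).
  rewrite He => [|A B hA hB AB]; last first.
    rewrite G0 ?scaler0 //; first by rewrite homs_rcons.
    by case/orP: AB => [/before_isVE_rcons-> | /before_isVE_cons->]; rewrite ?orbT.
  rewrite !scalerA map_rcons dsum_rcons !dsum_map //; congr (_ *: _); parity.
rewrite shf_swap He => [|A B hA hB AB]; last first.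
  rewrite G0 ?scaler0 //; first by rewrite homs_rcons.
  by case/orP: AB => [/before_isVE_rcons-> | /before_isVE_cons->]; rewrite ?orbT.
rewrite !scalerA map_rcons dsum_rcons dsum_cons !dsum_map //; congr (_ *: _); parity.
Qed.

(** Reading from the front, a letter of E extends [x], while a letter of V that precedes some letter
    of E opens a middle part, which ends at the last letter of E. *)
Lemma word_split u : exists x w, u = map toE x ++ map toV w \/
  exists dv v u' dx x0,
    u = map toE x ++ ((dv, inr v) :: rcons u' (dx, inl x0)) ++ map toV w.
Proof.
elim: u => [|[d [y|y]] u [x [w IH]]]; first by exists [::], [::]; left.
  exists ((d, y) :: x), w; case: IH => [->|[dv [v [u' [dx [x0 ->]]]]]]; first by left.
  by right; exists dv, v, u', dx, x0.
case: IH => [->|[dv [v [u' [dx [x0 ->]]]]]].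
  case/lastP: x => [|x [dx x0]]; first by exists [::], ((d, y) :: w); left.
  exists [::], w; right; exists d, y, (map toE x), dx, x0.
  by rewrite map_rcons.
exists [::], w; right; exists d, y, (map toE x ++ (dv, inr v) :: u'), dx, x0.
by rewrite /= rcons_cat /= -!catA.
Qed.

(** * The square on mixed words *)

Lemma zterm_before A B w suf : homs hW A -> homs hW B -> hW w.1 w.2 -> homs hW suf ->
  before noE noV (A ++ suf) || before noE noV (rcons B w) -> zterm lf suf w A B = 0.
Proof.
move=> hA hB hw hsuf /orP[bad|bad]; rewrite /zterm.
  rewrite lfrak_before ?scaler0 //; first exact: homs_outer.
  rewrite -cat1s !before_cat has_cat.
  by move: bad; rewrite before_cat => /or3P[->|->|/andP[-> ->]]; rewrite ?orbT.
(* Here the inner value is zero, and the outer bracket vanishes because it has a zero letter. *)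
by rewrite (lfrak_before _ bad) ?homs_rcons // lfrak_letter0 ?scaler0.
Qed.

(** An inner word ending in V has its value in V, and that value precedes the letter of E in
    [suf]. *)
Lemma zterm_noE A B w suf : homs hW A -> homs hW B -> hW w.1 w.2 -> homs hW suf ->
  noE w -> has noV suf -> zterm lf suf w A B = 0.
Proof.
move=> hA hB hw hsuf w0 s0; rewrite /zterm lfrak_before ?scaler0 //; first exact: homs_outer.
have r0 : noE (dsum B + w.1 + 1, lf (rcons B w)) by apply/eqP/lfrak_noE.
by rewrite before_cat /= r0 s0 /= orbT.
Qed.

(** An inner word ending in E has its value in E; the letter of V precedes this value in the outer
    word, or precedes [w] in the inner one. *)
Lemma zterm_noV A B w suf : homs hW A -> homs hW B -> hW w.1 w.2 -> homs hW suf ->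
  noV w -> has noE A || has noE B -> zterm lf suf w A B = 0.
Proof.
move=> hA hB hw hsuf w0 /orP[a0|b0]; last first.
  by rewrite zterm_before // -cats1 [before _ _ (B ++ _)]before_cat b0 /= w0 !orbT.
rewrite /zterm lfrak_before ?scaler0 //; first exact: homs_outer.
have r0 : noV (dsum B + w.1 + 1, lf (rcons B w)) by apply/eqP/lfrak_noV.
by rewrite before_cat a0 /= r0 /= !orbT.
Qed.

(** The inner bracket ends before [s1], so the badly ordered pair of [s1] stays in the outer
    word. *)
Lemma zsum_mixed_E x s1 : homs hE x -> homs hW s1 -> before noE noV s1 ->
  zsum (fun pre w suf => shf (zterm lf (suf ++ s1) w) pre) (map iE x) = 0.
Proof.
move=> hx h1 bad; apply: zsum0 => pre w suf s_eq.
have := homs_iE hx; rewrite s_eq homs_cat /= => -[hpre [hw hsuf]].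
apply: (shf0_homs hpre) => A B hA hB _; apply: zterm_before => //.
  by rewrite homs_cat.
by rewrite !before_cat bad /= !orbT.
Qed.

Lemma zsum_mixed_middle x p s q w : homs hW x -> homs hW (p :: rcons s q) -> homs hW w ->
  noE p -> noV q -> all (fun r => noE r || noV r) s ->
  zsum (fun pre r suf => shf (zterm lf (suf ++ w) r) (x ++ pre)) (p :: rcons s q) = 0.
Proof.
move=> hx hs hw p0 q0 s0; apply: zsum0 => pre r suf s_eq.
move: (hs); rewrite s_eq homs_cat => -[hpre [hr hsuf]].
have hpre' : homs hW (x ++ pre) by rewrite homs_cat.
have hsuf' : homs hW (suf ++ w) by rewrite homs_cat.
(* If the inner bracket ends at a letter [r] of V, then [q] still follows it; if [r] is in E, then
   [p] precedes it. *)
have {s_eq hs} /orP[/andP[r0 has_suf]|/andP[r0 has_pre]] :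
    (noE r && has noV suf) || (noV r && has noE pre).
  case/lastP: suf s_eq {hs hsuf hsuf'} => [|suf q'].
    rewrite cats1 -rcons_cons => /rcons_inj[<- <-].
    by rewrite q0 /= p0 orbT.
  rewrite -!rcons_cons -rcons_cat => /rcons_inj[]; case: pre {hpre hpre'} => [|p' pre] /= [<-].
    by rewrite p0 -cats1 has_cat /= => _ <-; rewrite q0 !orbT.
  move=> s_eq <-; move: s0; rewrite s_eq all_cat /= p0 -cats1 has_cat /= q0.
  by case/and3P=> _ /orP[->|->]; rewrite ?orbT.
  apply: (shf0_homs hpre') => A B hA hB _; apply: zterm_noE => //.
  by rewrite has_cat has_suf.
apply: (shf0_has hpre' (a := noE)) => [|A B hA hB AB]; first by rewrite has_cat has_pre orbT.
exact: zterm_noV.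
Qed.

(** The inner bracket must end in [w], and the middle word splits into [uE] and [uV]. The two halves
    of [pbr] come from [uV] being in the inner or in the outer bracket. *)
Lemma pcompZ_mixed u dv v dx x : homs hS u -> hV dv v -> hE dx x ->
  let uE := rcons (lefts u) (dx, x) in let uV := (dv, v) :: rights u in
  exists e, forall y w, homs hE y -> homs hV w ->
  pcompZ lf (map iE y ++ map emb ((dv, inr v) :: rcons u (dx, inl x)) ++ map iV w) =
  injV (ksgn K e *: shf (fun A B =>
    ksgn K (dsum A * dsum B + dsum A * dsum uV) *:
      pbr (fun t => phim B (uV ++ t)) (dsum B + dsum uV)
          (phi (A ++ uE)) (dsum A + dsum uE) w) y).
Proof.
move=> hu hv hx uE uV; set s := (dv, inr v) :: rcons u (dx, inl x).
have [e He] : exists e, forall G : _ -> _ -> E * V, (forall A B, homs hS A -> homs hS B ->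
      before isV isE A || before isV isE B -> G A B = 0) ->
    shf G s = ksgn K e *: (G (map toE uE) (map toV uV)
               + ksgn K (dsum uE * dsum uV) *: G (map toV uV) (map toE uE)).
  exact: shf_mixed.
(* The correction to the sign [e] of the middle unshuffle is what remains after comparison with the
   signs built into [pbr]. *)
exists (e + dsum uE * dsum uV + 1) => y w hy hw.
have hs : homs hS s by split=> //; rewrite homs_rcons.
have huE : homs hE uE by rewrite homs_rcons; split=> //; apply: homs_lefts.
have huV : homs hV uV by split=> //; apply: homs_rights.
have phimE xA : phim (xA ++ uE) = phi (xA ++ uE).
  by rewrite /phim /nilp /uE size_cat size_rcons addnS.
clearbody uE uV.
rewrite pcompZE !zsum_cat zsum_mixed_E //; last first.
- rewrite before_cat before_emb // /s before_isVE_cons //.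
  by rewrite -cats1 has_cat /= orbT.
- by rewrite homs_cat; split; [apply: homs_emb | apply: homs_iV].
have -> : zsum (fun pre r suf => shf (zterm lf (suf ++ map iV w) r) (map iE y ++ pre))
    (map emb s) = 0.
  rewrite /s [map emb _]/= map_rcons; apply: zsum_mixed_middle.
  - exact: homs_iE.
  - by rewrite -map_rcons -[_ :: _]/(map emb s); apply: homs_emb.
  - exact: homs_iV.
  - by rewrite /noE /= eqxx.
  - by rewrite /noV /= eqxx.
  - by elim: (u) => //= -[d [z|z]] u' ->; rewrite /noE /noV /= eqxx ?orbT.
rewrite !add0r zsum_map.
(* The first summand has [uV] in the inner bracket, the second has it in the outer one. *)
transitivity (zsum (fun pre r suf => shf (fun xA xB => injV (ksgn K e *:
  (ksgn K (dsum xB * dsum uE + dsum xA + dsum uE) *: shf (fun A B =>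
      ksgn K ((dsum xB + dsum uV + 1) * dsum A) *:
      phi (xA ++ uE) (A ++
        (dsum B + r.1 + (dsum xB + dsum uV + 1), phim xB (uV ++ rcons B r)) :: suf)) pre
   + ksgn K (dsum uE * dsum uV + dsum xB * dsum uV + dsum xA + dsum uV) *: shf (fun A B =>
      ksgn K ((dsum xB + dsum uE + 1) * dsum A) *:
      phim xA (uV ++ A ++
        (dsum B + r.1 + (dsum xB + dsum uE + 1), phi (xB ++ uE) (rcons B r)) :: suf)) pre))) y) w).
  apply: eq_zsum => pre r suf s_eq.
  move: hw; rewrite s_eq homs_cat => -[hpre [hr hsuf]].
  rewrite shf_cat shf_map //; apply: (eq_shf_homs hy) => xA xB hxA hxB _ _.
  rewrite shf_cat shf_map; last exact: emb1.
  rewrite He => [|A B hA hB AB]; last first.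
    rewrite shf_map //; apply: (shf0_homs hpre) => A2 B2 hA2 hB2 _.
    rewrite zterm_before ?scaler0 //.
    - by rewrite !homs_cat; do !split; [apply: homs_iE|apply: homs_emb|apply: homs_iV].
    - by rewrite !homs_cat; do !split; [apply: homs_iE|apply: homs_emb|apply: homs_iV].
    - by split=> //; apply: grading0.
    - exact: homs_iV.
    rewrite -!cats1 !before_cat.
    by case/orP: AB => /before_emb ->; rewrite !orbT.
  rewrite linearZ; congr (_ *: _); rewrite linearD; congr (_ + _).
    rewrite -shfZ -shf_linear shf_map //; apply: (eq_shf_homs hpre) => A B hA hB _ _.
    rewrite map_emb_toE map_emb_toV !catA -!map_cat -catA -!map_cat.
    rewrite zterm_EV ?homs_cat // phimE rcons_cat !dsum_cat !dsum_iE !dsum_iV.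
    rewrite !linearZ /= !scalerA; congr (_ *: injV (phi _ (_ ++ (_, _) :: _))); first parity.
    lia.
  rewrite -!shfZ -shf_linear shf_map //; apply: (eq_shf_homs hpre) => A B hA hB _ _.
  rewrite map_emb_toE map_emb_toV !catA -!map_cat -catA -!map_cat.
  rewrite zterm_EV ?homs_cat // phimE !dsum_cat !dsum_iE !dsum_iV !dsum_cat.
  rewrite !linearZ /= !scalerA; congr (_ *: injV (phim _ (_ ++ (_, _) :: _))); first parity.
  lia.
rewrite zsum_shf -!shfZ -shf_linear.
transitivity (shf (fun xA xB => injV (ksgn K e *:
  (ksgn K (dsum xB * dsum uE + dsum xA + dsum uE) *:
      ins (phi (xA ++ uE)) (fun t => phim xB (uV ++ t)) (dsum xB + dsum uV + 1) w
   + ksgn K (dsum uE * dsum uV + dsum xB * dsum uV + dsum xA + dsum uV) *: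
      ins (fun t => phim xA (uV ++ t)) (phi (xB ++ uE)) (dsum xB + dsum uE + 1) w))) y).
  apply: (eq_shf_homs hy) => xA xB hxA hxB _ _.
  rewrite zsum_linear zsumZ zsumD !zsumZ; congr (injV (_ *: (_ *: _ + _ *: _))).
    rewrite (ins_zsum (h := hV)) //.
      by apply/multilin_gsymmetric/phi_mlr; rewrite homs_cat.
    move=> t ht _; have hVt : homs hV (uV ++ t) by rewrite homs_cat.
    have := phim_deg hxB hVt; rewrite dsum_cat.
    by have -> : dsum uV + dsum t + (dsum xB + 1) = dsum t + (dsum xB + dsum uV + 1) by lia.
  rewrite (ins_zsum (h := hV)) //.
    move=> s1 s2 d1 d2 z1 z2 h1 h2 hz1 hz2; rewrite !catA.
    by apply: (multilin_gsymmetric (phim_ml hxA)); rewrite ?homs_cat.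
  move=> t ht _; have hBE : homs hE (xB ++ uE) by rewrite homs_cat.
  by have := phim_deg hBE ht; rewrite phimE dsum_cat.
under eq_shf do rewrite linearZ linearD.
(* Swapping the blocks of [y] in the second half makes [B] accompany [uV] and [A] accompany [uE] in
   both halves. *)
rewrite shfZ shfD [X in _ + X]shf_swap -shfD -shfZ; apply: eq_shf => A B.
rewrite -linearZ -linearD -linearZ /pbr !pcompE; congr injV.
rewrite !scalerDr !scalerN !scalerA -!ksgnD -scaleNr -ksgnS addrC.
congr (_ *: _ + _ *: _); parity.
Qed.

(** Additivity of the square splits the letters one after the other into their components in E and
    V; [u] holds the letters already split. *)
Lemma is_LodayInf_pure :
  (forall u, homs hS u -> (0 < size u)%N -> pcompZ lf (map emb u) = 0) ->
  is_LodayInf hW lf.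
Proof.
move=> pure s; suff H u : homs hS u -> homs hW s -> (0 < size u + size s)%N ->
    pcompZ lf (map emb u ++ s) = 0 by move=> hs s_gt0; apply: (H [::]).
elim: s u => [|[d [x v]] s IH] u hu /=.
  by rewrite addn0 cats0 => _; apply: pure.
move=> [[/= hx hv] hs] _.
have -> : (x, v) = (x, 0) + (0, v) by congr (_, _); rewrite /= ?addr0 ?add0r.
rewrite (pcompZD is_grading_hsum lfrak_deg lfrakD (homs_emb hu) hs); last first.
- by split=> //; apply: grading0.
- by split=> //; apply: grading0.
have iEE : (d, (x, 0)) = emb (d, inl x) by [].
have iVE : (d, (0, v)) = emb (d, inr v) by [].
rewrite -!cat_rcons iEE iVE -!map_rcons !IH ?addr0 ?size_rcons //; by rewrite homs_rcons.
Qed.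

(** * The morphism equation, coherence and the two implications *)

Lemma lefts_word v x : lefts (map toV v ++ map toE x) = x.
Proof.
by rewrite /lefts; elim: v => //=; elim: x => //= -[d x0] x ->.
Qed.

Lemma rights_word v x : rights (map toV v ++ map toE x) = v.
Proof.
by rewrite /rights; elim: v => [|[d v0] v IH] /=; [elim: x | rewrite IH].
Qed.

Hypothesis m_sq : forall w, homs hV w -> (0 < size w)%N -> Defs.pcomp m m 1 w = 0.
Hypothesis l_sq : forall x, homs hE x -> (0 < size x)%N -> Defs.pcomp l l 1 x = 0.
Hypothesis phi_morph : forall x w, homs hE x -> homs hV w ->
  (0 < size x)%N -> (0 < size w)%N ->
  \sum_(b <- masks (size x) | (0 < count id b)%N)
      ush_sign K b x *:
        phi ((dsum (mask b x) + 1, l (mask b x)) :: mask (map negb b) x) w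
  = - Defs.pcomp m (phi x) (dsum x + 1) w
    + ksgn K (dsum x + 1) *: Defs.pcomp (phi x) m 1 w
    + 2^-1 *: \sum_(b <- masks (size x) | (0 < count id b < size x)%N)
        ush_sign K b x *:
          pbr (phi (mask b x)) (dsum (mask b x))
              (phi (mask (map negb b) x)) (dsum (mask (map negb b) x)) w.

(* The two halves of the bracket are exchanged by swapping the two blocks of the unshuffle. *)
Lemma sum_pbr x w : homs hE x ->
  \sum_(b <- masks (size x) | (0 < count id b < size x)%N)
    ush_sign K b x *:
      pbr (phi (mask b x)) (dsum (mask b x))
          (phi (mask (map negb b) x)) (dsum (mask (map negb b) x)) w
  = - (2 *: shf (fun A B => if nilp A || nilp B then 0 else
        ksgn K (dsum A) *: ins (phim A) (phim B) (dsum B + 1) w) x).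
Proof.
move=> hx; rewrite (sum_masks_mkcond (fun n => 0 < n < size x)%N
  (fun A B => pbr (phi A) (dsum A) (phi B) (dsum B) w)).
set H := fun A B => if nilp A || nilp B then 0 else _.
rewrite scaler_nat mulr2n [X in _ + X]shf_swap -shfD -scaleN1r -shfZ.
apply: (eq_shf_homs hx) => A B _ _ s_eq _; rewrite scaleN1r -s_eq /H [nilp B || _]orbC.
have -> : (0 < size A < size A + size B)%N = ~~ (nilp A || nilp B).
  by rewrite -{2}[size A]addn0 ltn_add2l negb_or /nilp -!lt0n.
case: ifP => [|/negbFE ->]; last by rewrite scaler0 addr0 oppr0.
case: A {s_eq} => [|p A] //; case: B => [|q B] // _.
rewrite /phim /pbr !pcompE /= scalerBr opprD !scalerA -!scaleNr -!ksgnD -!ksgnS.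
by congr (_ *: _ + _ *: _); parity.
Qed.

(** The two unshuffles of [x] with an empty block give the terms with M_V of the morphism equation;
    the others give half the sum of brackets, the factor 2 of [sum_pbr] cancelling [2^-1]. *)
Lemma pcompZ_action x w : homs hE x -> homs hV w -> (0 < size x)%N -> (0 < size w)%N ->
  pcompZ lf (map iE x ++ map iV w) = 0.
Proof.
move=> hx hw x_gt0 w_gt0; rewrite pcompZ_EV // [X in _ + X](shf_ends _ hx) //.
have := phi_morph hx hw x_gt0 w_gt0; rewrite sum_pbr //.
rewrite (sum_masks_mkcond (fun n => 0 < n)%N
  (fun A B => phi ((dsum A + 1, l A) :: B) w)) !pcompE.
have -> : shf (fun A B => if (0 < size A)%N then phi ((dsum A + 1, l A) :: B) w else 0) x
   = ins (phi^~ w) l 1 x by apply: eq_shf => -[].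
move=> ->; rewrite scalerN scalerA mulVf ?pnatr_eq0 // scale1r.
have phimE : phim x = phi x by case: (x) x_gt0.
rewrite dsum_nil add0r phimE ksgnS scaleNr scale1r.
by rewrite -!opprD -[X in _ + X]addrA [X in _ + X]addrC addNr linear0.
Qed.

(* Induction on [size y]: all unshuffles of [y] but the one keeping it whole vanish. *)
Lemma coherence_of_Loday : is_LodayInf hW lf ->
  forall y x v w, homs hE y -> homs hE x -> homs hV v -> homs hV w ->
    (0 < size x)%N -> (0 < size v)%N ->
    pbr (fun t => phim y (v ++ t)) (dsum y + dsum v) (phi x) (dsum x) w = 0.
Proof.
move=> loday y; have [n] := ubnP (size y).
elim: n y => // n IH y; rewrite ltnS => y_le x v w hy hx hv hw x_gt0 v_gt0.
case/lastP: x hx x_gt0 => [|x [dx x0]] // /homs_rcons[hx hx0] _.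
case: v hv v_gt0 => [|[dv v0] v] // [hv0 hv] _.
(* The middle word is chosen as all of [v] followed by all of [x], so that its subwords in V and E
   are the given ones. *)
have hu : homs hS (map toV v ++ map toE x).
  by rewrite homs_cat; split; [apply: homs_map hv | apply: homs_map hx].
have [e] := pcompZ_mixed hu hv0 hx0.
rewrite lefts_word rights_word => /(_ y w hy hw); rewrite loday; last first.
- by rewrite !size_cat /= addnS.
- rewrite !homs_cat; split; [exact: homs_iE | split; [|exact: homs_iV]].
  by apply: homs_emb; split=> //; rewrite homs_rcons.
move=> /esym[/eqP]; rewrite scaler_eq0 => /orP[|/eqP].
  by rewrite /ksgn; case: ifP; rewrite ?oppr_eq0 oner_eq0.
(* For nonempty [A] the block [B] is shorter than [y], and the induction hypothesis applies with [A]
   prepended to the argument [x] of the other coderivation. *)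
rewrite (shf_left_nil hy) => [|A B hA hB AB A_gt0]; last first.
  rewrite -dsum_cat (IH B _ (A ++ rcons x (dx, x0)) ((dv, v0) :: v) w) ?scaler0 //.
  - by rewrite -AB in y_le; apply: leq_trans y_le; rewrite -addn1 addnC leq_add2r.
  - by rewrite homs_cat homs_rcons.
  - by rewrite size_cat size_rcons addnS.
by rewrite dsum_nil !mul0r addr0 scale1r add0r.
Qed.

Lemma Loday_of_coherence : coherent hE hV m phi -> is_LodayInf hW lf.
Proof.
move=> coh; apply: is_LodayInf_pure => u hu u_gt0.
have [x [w [u_eq|[dv [v [u' [dx [x0 u_eq]]]]]]]] := word_split u.
  have [hx hw] : homs hE x /\ homs hV w.
    move: hu; rewrite u_eq homs_cat => -[/homs_lefts hx /homs_rights hw].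
    by rewrite -(lefts_word [::] x) -(rights_word w [::]) /= cats0.
  rewrite u_eq map_cat map_emb_toE map_emb_toV; have [w0|w_gt0] := posnP (size w).
    rewrite (size0nil w0) cats0 pcompZ_E //; last first.
      by move: u_gt0; rewrite u_eq size_cat !size_map w0 addn0.
    by rewrite -pcompE l_sq ?linear0 //; move: u_gt0; rewrite u_eq size_cat !size_map w0 addn0.
  have [x0|x_gt0] := posnP (size x); last exact: pcompZ_action.
  rewrite (size0nil x0) pcompZ_EV // /ins shf_nil add0r shf_nil -/(ins _ _ _ _).
  by rewrite dsum_nil add0r scale1r -pcompE m_sq // linear0.
move: hu; rewrite u_eq !homs_cat.
move=> -[/homs_lefts hx [[hv /homs_rcons[hu' hx0]] /homs_rights hw]].
have {}hx : homs hE x by rewrite -(lefts_word [::] x).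
have {}hw : homs hV w by rewrite -(rights_word w [::]) /= cats0.
rewrite map_cat map_cat map_emb_toE map_emb_toV.
have [e ->] := pcompZ_mixed hu' hv hx0; rewrite // (shf0_homs hx) ?scaler0 ?linear0 //.
move=> A B hA hB _; set uE := rcons _ _; set uV := _ :: rights _.
have hAE : homs hE (A ++ uE).
  by rewrite homs_cat homs_rcons; split=> //; split=> //; apply: homs_lefts.
have hVV : homs hV uV by split=> //; apply: homs_rights.
have AE_gt0 : (0 < size (A ++ uE))%N by rewrite size_cat size_rcons addnS.
(* Coherence speaks of nonempty [w]; on the empty word both compositions vanish, as the inner block
   would be empty. *)
have [w0|w_gt0] := posnP (size w).
  by rewrite (size0nil w0) /pbr !pcompE /ins !shf_nil !scaler0 subr0 !scaler0.
rewrite -dsum_cat; case: B hB => [|p B] hB.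
  (* The identity for [ad] does not involve [y], and [A ++ uE] is only a nonempty word filling its
     place. *)
  have [coh_ad _] := coh _ _ uV w hAE hAE hVV hw AE_gt0 AE_gt0 isT w_gt0.
  by rewrite !dsum_nil add0r [pbr _ _ _ _ _]coh_ad scaler0.
have [_ coh_phi] := coh _ _ uV w hAE hB hVV hw AE_gt0 isT isT w_gt0.
by rewrite [pbr _ _ _ _ _]coh_phi scaler0.
Qed.

End LodayBrackets.

Theorem theoremA (K : numFieldType) (E V : lmodType K)
  (hE : int -> E -> Prop) (hV : int -> V -> Prop)
  (l : seq (int * E) -> E) (m : seq (int * V) -> V)
  (phi : seq (int * E) -> seq (int * V) -> V) :
  is_LieInf hE l -> is_LieInf hV m -> is_LieInf_action hE hV l m phi ->
  (is_LodayInf (hsum hE hV) (lfrak l m phi) <-> coherent hE hV m phi).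
Proof.
move=> [gE l_ml l_deg l_sq] [gV m_ml m_deg m_sq] [phi_deg phi_mlr phi_mll phi_morph].
split=> [loday x y v w hx hy hv hw x_gt0 y_gt0 v_gt0 w_gt0 | coh].
  have H := coherence_of_Loday gE gV l_ml l_deg m_ml m_deg phi_deg phi_mlr phi_mll loday.
  (* An empty [y] yields the brackets with [ad], a nonempty one those with Phi_{y;v}. *)
  split; first by have := H [::] x v w I hx hv hw x_gt0 v_gt0; rewrite dsum_nil add0r.
  by have := H y x v w hy hx hv hw x_gt0 v_gt0; case: (y) y_gt0.
exact: Loday_of_coherence coh.
Qed.
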